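(* For any integer $n\geq 4$, the symmetric group $S_n$ is not a $POS$-group.
   Context: For a finite group $G$ and $x\in G$, let $o(x)$ denote the order of $x$. The order subset of $G$ determined by $x$ is $\overline{x}=\{y\in G : o(y)=o(x)\}$. A finite group $G$ is called a $POS$-group (group with perfect order subsets) if for every $x\in G$ the number of elements of $\overline{x}$ is a divisor of $|G|$. $S_n$ denotes the symmetric group on $n$ letters. *)

(* Defs.v *)
From mathcomp Require Import all_boot all_fingroup.

Set Implicit Arguments.
Unset Strict Implicit.
Unset Printing Implicit Defensive.

Local Open Scope group_scope.

Definition order_subset (gT : finGroupType) (G : {group gT}) (x : gT)
  : {set gT} := [set y in G | #[y] == #[x]].

Definition POS_group (gT : finGroupType) (G : {group gT}) : Prop :=
  forall x, x \in G -> #|order_subset G x| %| #|G|.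

(* Main.v *)
Require Import Defs.
From Stdlib Require Import NArith.
From mathcomp Require Import all_boot all_fingroup.
From mathcomp Require Import all_order all_algebra all_solvable.
From mathcomp Require Import zify ring lra.

Set Implicit Arguments.
Unset Strict Implicit.
Unset Printing Implicit Defensive.

Import Order.TTheory GRing.Theory Num.Theory.

(**
Let [p] be a prime, write [n = k p + r] with [r < p], and let [N] be the number
of elements of order [p] in the symmetric group on [n] letters.  They are the
products of [j] disjoint [p]-cycles with [1 <= j <= k], so
[[
  N / n! = sum_(1 <= j <= k) 1 / (p^j j! (n - j p)!) = 1 / A + S,
]]
where [A = p^k k! r!] comes from [j = k] and [S] collects the other terms.  If
the group had perfect order subsets, [N] would divide [n!], so [1 / A + S]
would be the inverse of an integer.  But when [k >= 2] and [p] is not too small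
compared with [n], the sum [S] is positive and much smaller than the gap,
which exceeds [1 / A^2], between [1 / A] and the next larger unit fraction
[1 / (A - 1)] (lemma [unit_fraction_gap]).  Since [(n - j p)! >= (p + r)!] for
[j < k], and [(p + r)! >= 2^(p-1) r!^2], the condition
[2 n log2 n <= p (p - 1)] together with [2 p <= n] is enough
([not_POS_of_prime]).

Hence any prime between roughly [sqrt (2 n log2 n)] and [n / 2] will do, a range
so wide that Chebyshev's first argument finds one: no prime power dividing a
binomial coefficient ['C(2 m, m)] exceeds [2 m], while ['C(2 m, m) >= 2 ^ m], so
['C(2 m, m)] has at least [m / log2 (2 m)] prime divisors, and with [m = n / 4]
one of them is large ([prime_in_range]).  This works for [n >= 2 ^ 18]; five
explicit primes serve [2 ^ 8 <= n < 2 ^ 18].  For [n < 2 ^ 8] the prime [2]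
suffices, as the number of involutions can be computed and does not divide [n!].

The formula for [N / n!] is obtained by induction on the number of points, from
the recurrence [card_prime_roots_rec], which looks at the cycle through a
chosen point.
*)

(** * Permutations whose p-th power is trivial *)

(** The identity is kept, and the support is confined to a variable set of
points, because this is the family that satisfies a recurrence; for prime [p]
it consists of the identity and the elements of order [p]. *)
Definition prime_roots (T : finType) (p : nat) (A : {set T}) : {set {perm T}} :=
  [set x : {perm T} | perm_on A x & (x ^+ p == 1)%g].

Definition cycle_perm (T : finType) (c : seq T) (Uc : uniq c) : {perm T} :=
  perm (can_inj (prev_next Uc)).

Lemma prime_roots_fixing (T : finType) p (A : {set T}) a : a \in A ->
  [set x in prime_roots p A | x a == a] = prime_roots p (A :\ a).
Proof.
move=> aA; apply/setP => x; rewrite !inE.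
case: (x ^+ p == 1)%g; rewrite ?andbF //= !andbT.
apply/andP/idP => [[/subsetP xA /eqP xa]|/subsetP xA].
  apply/subsetP => z xz; rewrite !inE xA // andbT.
  by apply: contraNneq xz => ->; rewrite xa eqxx.
split; first by apply/subsetP => z /xA; rewrite !inE => /andP[].
by apply: contraT => /xA; rewrite !inE eqxx.
Qed.

(** The orbits of a permutation whose [p]-th power is trivial have size [1] or
[p], so the orbit of a moved point is a [p]-cycle that can be read off by
iterating from that point. *)
Lemma prime_root_cycle (T : finType) p (A : {set T}) a x :
    prime p -> x \in prime_roots p A -> a \in A -> x a != a ->
  let t := traject x (x a) p.-1 in
  [/\ fcycle x (a :: t), uniq (a :: t) & {subset t <= A :\ a}].
Proof.
move=> p_pr; rewrite inE => /andP[xA /eqP xp1] aA xa.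
have p_gt0 := prime_gt0 p_pr.
have def_c : a :: traject x (x a) p.-1 = traject x a p.
  by rewrite -trajectS prednK.
have xpa : iter p x a = a by rewrite -permX xp1 perm1.
have Uc : uniq (traject x a p).
  have o_dv : #|porbit x a| %| p.
    have -> : porbit x a = orbit 'P <[x]> a by rewrite porbit.unlock.
    by apply: dvdn_trans (dvdn_orbit _ _ _) _; rewrite -orderE order_dvdn xp1.
  have o_n1 : #|porbit x a| != 1.
    apply: contraNneq xa => o1; apply/eqP.
    by have := iter_porbit x a; rewrite o1.
  case/primeP: p_pr => _ /(_ _ o_dv); rewrite (negPf o_n1) => /eqP <-.
  exact: uniq_traject_porbit.
split; last 1 first.
- move=> z zt; rewrite !inE.
  move: Uc; rewrite -def_c /= => /andP[at_ _].
  have -> /= : z != a by apply: contraNneq at_ => za; rewrite -{1}za.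
  case/trajectP: zt => i _ ->.
  by elim: i => [|i IH] /=; rewrite perm_closed.
- suff: fpath x a (rcons (traject x (x a) p.-1) a) by [].
  have -> : rcons (traject x (x a) p.-1) a = traject x (x a) p.
    by rewrite -{2}(prednK p_gt0) trajectSr -iterSr prednK // xpa.
  exact: fpath_traject.
- by rewrite def_c.
Qed.

Lemma fcycle_iter (T : eqType) (f : T -> T) (c : seq T) z :
  fcycle f c -> z \in c -> iter (size c) f z = z.
Proof.
move=> fc /rot_to[i q rot_c].
have fzq : fcycle f (z :: q) by rewrite -rot_c rot_cycle.
have /fpathE zq := fzq; rewrite -(size_rot i) rot_c -last_traject.
by move: zq; rewrite size_rcons [size (z :: q)]/= => <-; rewrite last_rcons.
Qed.

Lemma cycle_perm_on (T : finType) (c : seq T) (Uc : uniq c) :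
  perm_on [set z in c] (cycle_perm Uc).
Proof.
apply/subsetP => z; rewrite !inE permE.
by apply: contraNT => /negPf zc; rewrite next_nth zc.
Qed.

(** Left multiplication by the cycle [c] is a bijection from the permutations
supported off [c] to those that act on [c] as that cycle: the two factors have
disjoint supports, so their [p]-th powers are independent of one another. *)
Lemma card_prime_roots_cycle (T : finType) p (A : {set T}) (c : seq T) :
    uniq c -> size c = p -> {subset c <= A} ->
  #|[set x in prime_roots p A | fcycle x c]|
    = #|prime_roots p (A :\: [set z in c])|.
Proof.
move=> Uc sz_c cA; set s := cycle_perm Uc.
have s_on := cycle_perm_on Uc.
rewrite -[RHS](card_imset _ (mulgI s)); apply: eq_card => x.
have sE z : z \in c -> s z \in c by rewrite permE mem_next.
apply/idP/imsetP => [|[y]]; rewrite !inE; last first.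
  move=> /andP[y_on /eqP yp1] ->.
  have yE z : z \in c -> y z = z.
    by move=> zc; apply: (out_perm y_on); rewrite !inE zc.
  have syc : fcycle (s * y)%g c.
    apply: cycle_from_next => // z zc; apply/eqP.
    by rewrite permM yE ?sE // permE.
  rewrite syc andbT; apply/andP; split.
    apply: perm_onM.
      by apply: (subset_trans s_on); apply/subsetP => z; rewrite inE => /cA.
    by apply: (subset_trans y_on); exact: subsetDl.
  apply/eqP/permP => z; rewrite perm1 permX.
  have [zc|zc] := boolP (z \in c); first by rewrite -sz_c fcycle_iter.
  have yz i : iter i (s * y)%g z = iter i y z /\ iter i y z \notin c.
    elim: i => [|i [IH1 IH2]] //=.
    rewrite IH1 permM (out_perm s_on) ?inE //; split=> //.
    by apply: contra IH2 => yc; rewrite -(perm_inj (yE _ yc)).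
  by rewrite (yz p).1 -permX yp1 perm1.
move=> /andP[/andP[x_on /eqP xp1] xc].
have xE z : z \in c -> x z = s z by move=> zc; rewrite permE (nextE xc).
have sVE z : z \in c -> (s^-1)%g z \in c.
  move=> zc; suff nz : next c (s^-1 z)%g = z by rewrite -mem_next nz.
  by rewrite -[RHS](permKV s) [RHS]permE.
have sVx z : z \in c -> (s^-1 * x)%g z = z.
  by move=> zc; rewrite permM xE ?permKV ?sVE.
exists (s^-1 * x)%g; last by rewrite mulKVg.
rewrite inE; apply/andP; split.
  apply/subsetP => z; rewrite !inE; apply: contraNT.
  rewrite negb_and negbK => /orP[/sVx -> //|zA].
  rewrite permM (out_perm (perm_onV s_on)) ?(out_perm x_on) ?eqxx //.
  by rewrite inE; apply: contra zA => /cA.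
apply/eqP/permP => z; rewrite perm1 permX.
have [zc|zc] := boolP (z \in c).
  by elim: {1}p => [|i IH] //=; rewrite IH sVx.
have yz i : iter i (s^-1 * x)%g z = iter i x z /\ iter i x z \notin c.
  elim: i => [|i [IH1 IH2]] //=.
  rewrite IH1 permM (out_perm (perm_onV s_on)) ?inE //; split=> //.
  apply: contra IH2 => xyc.
  suff /perm_inj <- : x (s^-1 (x (iter i x z)))%g = x (iter i x z).
    exact: sVE.
  by rewrite -permM sVx.
by rewrite (yz p).1 -permX xp1 perm1.
Qed.

(** Either [a] is fixed, or it lies on a [p]-cycle; that cycle is given by the
[p.-1] other points in the order in which they are met from [a], and the
rest of the permutation lives on the remaining [#|A| - p] points.  The value
[M] only has a meaning when [p <= #|A|]; otherwise the falling factorial is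
zero. *)
Lemma card_prime_roots_rec (T : finType) p (A : {set T}) a M :
    prime p -> a \in A ->
    (forall B : {set T},
       p <= #|A| -> #|B| = #|A| - p -> #|prime_roots p B| = M) ->
  #|prime_roots p A|
    = #|prime_roots p (A :\ a)| + #|A|.-1 ^_ p.-1 * M.
Proof.
move=> p_pr aA HM; have p_gt0 := prime_gt0 p_pr.
rewrite -(cardID [pred x : {perm T} | x a == a]); congr (_ + _).
  by rewrite -prime_roots_fixing //; apply: eq_card => x; rewrite !inE andbC.
pose tup (x : {perm T}) : p.-1.-tuple T :=
  Tuple (introT eqP (size_traject x (x a) p.-1)).
pose P (t : p.-1.-tuple T) := all [in A :\ a] t && uniq t.
rewrite -[LHS]sum1_card (partition_big tup P) => [|x]; last first.
  rewrite inE /= => /andP[xa xR].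
  have [_ /= /andP[_ Ut] sub] := prime_root_cycle p_pr xR aA xa.
  by rewrite /P Ut andbT; apply/allP.
have -> : #|A|.-1 ^_ p.-1 = #|[set t | P t]|.
  by rewrite card_uniq_tuples (cardsD1 a A) aA.
rewrite -sum_nat_const.
apply: eq_big => [t|t /andP[/allP tA Ut]]; first by rewrite inE.
have at_ : a \notin t by apply/negP => /tA; rewrite !inE eqxx.
have Uc : uniq (a :: t) by rewrite /= at_.
have sz_c : size (a :: t) = p by rewrite /= size_tuple prednK.
have cA : {subset a :: t <= A}.
  by move=> z; rewrite inE => /predU1P[-> //|/tA]; rewrite inE => /andP[].
rewrite sum1_card.
have card_c : #|[set z in a :: t]| = p by rewrite cardsE (card_uniqP Uc).
have c_sub : [set z in a :: t] \subset A.
  by apply/subsetP => z; rewrite inE => /cA.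
rewrite -[RHS](HM (A :\: [set z in a :: t])); first last.
- by rewrite cardsD (setIidPr c_sub) card_c.
- by rewrite -card_c; exact: subset_leq_card.
rewrite -card_prime_roots_cycle //.
apply: eq_card => x; rewrite unfold_in !inE.
apply/idP/idP.
  move=> /andP[/andP[xa /andP[xA xp1]] /eqP <-].
  have xR : x \in prime_roots p A by rewrite inE xA.
  by have [xc _ _] := prime_root_cycle p_pr xR aA xa; rewrite xA xp1.
move=> /andP[/andP[-> ->] xc]; rewrite !andbT.
have fx : fpath x a (rcons t a) by [].
have /fpathE tE := fx.
have tE' : t = traject x (x a) p.-1 :> seq T.
  by move: tE; rewrite size_rcons size_tuple trajectSr; case/rcons_inj.
have tupE : tup x = t by apply: val_inj; rewrite /= -tE'.
rewrite tupE eqxx andbT.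
apply: contra at_ => /eqP xa.
have : 0 < p.-1 by have := prime_gt1 p_pr; case: (p) => [|[|]].
rewrite memtE tE'; case: (p.-1) => // q _.
by rewrite trajectS xa inE eqxx.
Qed.

(** * The exact proportion of such permutations *)

Section Density.
Local Open Scope ring_scope.

(** The probability that a random permutation of [m] points is a product of [j]
disjoint [p]-cycles. *)
Definition cycles_density (p j m : nat) : rat :=
  if (j * p <= m)%N then ((p ^ j * j`! * (m - j * p)`!)%:R)^-1 else 0.

(** The identity [m+1 = (m+1 - j p) + j p] splits the left-hand side: the first
summand cancels the top factor of [(m+1 - j p)!], the second one the factor
[p j] of [p^j j!]. *)
Lemma cycles_density_rec p j m : (0 < p)%N ->
  m.+1%:R * cycles_density p j m.+1
    = cycles_density p j m
      + (if (0 < j)%N && (p <= m.+1)%N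
         then cycles_density p j.-1 (m.+1 - p) else 0).
Proof.
move=> p_gt0.
have nz (k : nat) : (0 < k)%N -> (k%:R : rat) != 0 by rewrite pnatr_eq0 -lt0n.
have fnz k : (k`!%:R : rat) != 0 by rewrite nz ?fact_gt0.
have pnz k : ((p ^ k)%:R : rat) != 0 by rewrite nz ?expn_gt0 ?p_gt0.
rewrite /cycles_density.
case: j => [|j] /=.
  rewrite !mul0n !subn0 addr0 expn0 fact0 !mul1n factS natrM.
  by field; rewrite fnz nat1r nz.
have [le1|gt1] := leqP (j.+1 * p) m.+1; last first.
  rewrite mulr0 ifF; last by apply/negbTE; lia.
  rewrite add0r; case: ifP => // pm; rewrite ifF //; apply/negbTE; nia.
have -> : (p <= m.+1)%N by nia.
have -> : (j * p <= m.+1 - p)%N by nia.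
have -> : (m.+1 - p - j * p = m.+1 - j.+1 * p)%N by nia.
have [le2|gt2] := leqP (j.+1 * p) m.
  rewrite subSn // (factS (m - _)) (factS j) expnS !natrM.
  set q := (m - j.+1 * p)%N.
  have -> : m.+1%:R = q.+1%:R + j.+1%:R * p%:R :> rat.
    by rewrite -natrM -natrD; congr (_%:R); rewrite /q; lia.
  by field; rewrite !fnz !nat1r pnz !nz.
have -> : m.+1 = (j.+1 * p)%N by lia.
rewrite subnn fact0 muln1 (factS j) expnS !natrM.
by field; rewrite fnz pnz nat1r !nz.
Qed.

Lemma sum_cycles_density_rec p K m : (0 < p)%N -> (m.+1 < K)%N ->
  m.+1%:R * (\sum_(j < K) cycles_density p j m.+1)
    = (\sum_(j < K) cycles_density p j m)
      + (if (p <= m.+1)%N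
         then \sum_(j < K) cycles_density p j (m.+1 - p) else 0).
Proof.
move=> p_gt0 mK; rewrite mulr_sumr.
under eq_bigr do rewrite cycles_density_rec //.
rewrite big_split /=; congr (_ + _).
case: K mK => // K mK; rewrite big_ord_recl /= add0r.
case: ifP => [pm|_]; last by rewrite big1.
rewrite big_ord_recr /= [X in _ = _ + X]ifF ?addr0 //.
apply/negbTE; nia.
Qed.

(** Both sides satisfy the same recurrence in the number of points.  The terms
with [j p > #|A|] vanish, so the bound [K] can be any large number; leaving it
free lets one fixed range serve throughout the induction. *)
Lemma card_prime_rootsE (T : finType) p (A : {set T}) K :
    prime p -> (#|A| < K)%N ->
  #|prime_roots p A|%:R
    = #|A|`!%:R * \sum_(j < K) cycles_density p j #|A| :> rat.
Proof.
move=> p_pr; have [n] := ubnP #|A|; elim: n => // n IH in A *.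
rewrite ltnS => An AK.
have [A0|[a aA]] := set_0Vmem A.
  have -> : prime_roots p A = [set 1%g].
    apply/setP => x; rewrite !inE; apply/andP/eqP => [[x0 _]|->].
      by apply: (perm_on_id x0); rewrite A0 cards0.
    by rewrite perm_on1 expg1n.
  rewrite cards1 A0 cards0 mul1r.
  case: (K) (AK) => // K' _; rewrite big_ord_recl big1 ?addr0 => [|i _].
    by rewrite /cycles_density mul0n subnn muln1 invr1.
  by rewrite /cycles_density ifF //= leqn0 muln_eq0 /= -leqn0 leqNgt prime_gt0.
have cA : #|A| = #|A :\ a|.+1 by rewrite (cardsD1 a A) aA.
set m := #|A :\ a| in cA.
(* The recurrence needs a common value for the sets of size [#|A| - p]; that of
   one such set is used, the induction hypothesis showing they all agree. *)
have [B0 HB0] : exists B : {set T}, (p <= #|A|)%N -> #|B| = (#|A| - p)%N.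
  have : (0 < #|[set B : {set T} | B \subset A & #|B| == #|A| - p]|)%N.
    by rewrite cards_draws bin_gt0 leq_subr.
  by case/card_gt0P => B; rewrite inE => /andP[_ /eqP]; exists B.
have p_gt0 := prime_gt0 p_pr.
have IHp (B : {set T}) : (p <= #|A|)%N -> #|B| = (#|A| - p)%N ->
    #|prime_roots p B|%:R = (#|A| - p)`!%:R
        * \sum_(j < K) cycles_density p j (#|A| - p) :> rat.
  by move=> pA cB; rewrite IH ?cB //; lia.
rewrite (card_prime_roots_rec (M := #|prime_roots p B0|) p_pr aA); last first.
  move=> B pA cB; apply/eqP; rewrite -(eqr_nat rat).
  by rewrite !IHp ?HB0.
rewrite natrD IH; try lia.
rewrite cA /= in HB0 IHp AK *.
rewrite -/m (factS m) [(m.+1 * _)%:R]natrM [m.+1%:R * _]mulrC -mulrA.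
rewrite sum_cycles_density_rec // mulrDr; congr (_ + _).
case: ifP => pm; last by rewrite ffact_small ?mulr0 ?mul0n //; lia.
rewrite natrM (IHp B0) ?HB0 // mulrA -natrM; congr (_%:R * _).
have -> : (m.+1 - p = m - p.-1)%N by lia.
by apply: ffact_fact; lia.
Qed.

End Density.

(** * Symmetric groups excluded by a suitable prime *)

Lemma order_subset_prime n p (x : 'S_n) : prime p -> #[x]%g = p ->
  #|order_subset [set: 'S_n]%G x|.+1 = #|prime_roots p [set: 'I_n]|.
Proof.
move=> p_pr ox.
rewrite [RHS](cardsD1 1%g) inE perm_on1 expg1n eqxx add1n; congr _.+1.
apply: eq_card => y; rewrite !inE ox.
have -> : perm_on [set: 'I_n] y by apply/subsetP => z _; rewrite inE.
apply/eqP/andP => [oy | [y1 /eqP yp]].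
  split; last by rewrite -oy expg_order eqxx.
  by apply/eqP => y1; move: p_pr; rewrite -oy y1 order1.
have: #[y]%g %| p by rewrite order_dvdn yp.
by case/primeP: p_pr => _ h /h; rewrite order_eq1 (negPf y1) => /eqP.
Qed.

(** The divisibility condition is only imposed on orders that occur, hence the
use of Cauchy's theorem. *)
Lemma POS_dvd n p : prime p -> p <= n -> POS_group [set: 'S_n]%G ->
  #|prime_roots p [set: 'I_n]|.-1 %| n`!.
Proof.
move=> p_pr pn posS.
have cS : #|[set: 'S_n]| = n`!.
  transitivity #|[set: 'I_n]|`!; last by rewrite cardsT card_ord.
  rewrite -card_perm.
  apply: eq_card => y; rewrite inE; symmetry.
  by apply/subsetP => z _; rewrite inE.
have [|x _ ox] := @Cauchy _ p [set: 'S_n]%G p_pr.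
  by rewrite cS dvdn_fact // prime_gt0.
by have := posS x (in_setT x); rewrite cS -(order_subset_prime p_pr ox).
Qed.

Lemma leq_fact_exp k : k`! <= k ^ k.
Proof.
elim: k => // k IH; rewrite factS expnS leq_mul2l /=.
by apply: leq_trans IH _; case: k => // k; rewrite leq_exp2r.
Qed.

(** From [p! >= 2^(p-1-r) r!] and [(p + s)! >= 2^s s! p!] for [s <= p], the
latter because each new factor [p + s + 1] is at least [2 (s + 1)]. *)
Lemma fact_add_lower p r : r < p -> 2 ^ p.-1 * r`! ^ 2 <= (p + r)`!.
Proof.
move=> rp.
have H1 : 2 ^ (p.-1 - r) * r`! <= p`!.
  have [s ->] : exists s, p = r.+1 + s by exists (p - r.+1); lia.
  rewrite (_ : (r.+1 + s).-1 - r = s); last by lia.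
  elim: s => [|s IH]; first by rewrite expn0 mul1n addn0 factS leq_pmull.
  by rewrite addnS factS expnS -mulnA leq_mul.
have H2 s : s <= p -> 2 ^ s * s`! * p`! <= (p + s)`!.
  elim: s => [|s IH] sp; first by rewrite !mul1n addn0.
  rewrite addnS factS [X in _ <= X]factS expnS; have {}IH := IH (ltnW sp).
  have -> : 2 * 2 ^ s * (s.+1 * s`!) * p`! = (2 * s.+1) * (2 ^ s * s`! * p`!).
    by ring.
  by apply: leq_mul => //; lia.
apply: leq_trans (H2 r (ltnW rp)).
rewrite (_ : p.-1 = r + (p.-1 - r)); last by lia.
rewrite expnD.
rewrite (_ : _ * _ * _ = 2 ^ r * r`! * (2 ^ (p.-1 - r) * r`!)); last by ring.
by rewrite leq_mul2l H1 orbT.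
Qed.

Section Gap.
Local Open Scope ring_scope.

Lemma sum_cycles_density p n K : (0 < p)%N -> (n < K)%N ->
  \sum_(j < K) cycles_density p j n
    = \sum_(j < (n %/ p).+1) cycles_density p j n.
Proof.
move=> p_gt0 nK.
have kK : ((n %/ p).+1 <= K)%N by apply: leq_trans nK; rewrite ltnS leq_div.
rewrite (big_ord_widen _ (fun j => cycles_density p j n) kK) [RHS]big_mkcond.
apply: eq_bigr => j _; case: ifP => // /negbT.
by rewrite ltnS leq_divRL // /cycles_density => /negPf ->.
Qed.

(** If [1/A + S = 1/D] then [A - D = D (A S)] is a positive integer, but it is
smaller than [A^2 S <= 1]. *)
Lemma unit_fraction_gap (A D : nat) (S : rat) :
  0 < S -> A%:R ^+ 2 * S <= 1 -> (0 < A)%N -> D%:R * (A%:R^-1 + S) != 1.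
Proof.
move=> S_gt0 AS A_gt0; apply/eqP => DS.
have A0 : (0 : rat) < A%:R by rewrite ltr0n.
have DA : D%:R * (1 + A%:R * S) = A%:R.
  transitivity (A%:R * (D%:R * (A%:R^-1 + S))); last by rewrite DS mulr1.
  by field; rewrite gt_eqF.
have D0 : (0 < D)%N.
  by case: D DA {DS} => //; rewrite mul0r => H; rewrite -H ltxx in A0.
have DR : (0 : rat) < D%:R by rewrite ltr0n.
have lt1 : (D%:R : rat) < A%:R.
  by rewrite -DA mulrDr mulr1 ltrDl !mulr_gt0.
have le1 : (D%:R : rat) + 1 <= A%:R by rewrite natr1 ler_nat -(ltr_nat rat).
have : D%:R * (A%:R * S) < A%:R * (A%:R * S) by rewrite ltr_pM2r // mulr_gt0.
by move: DA AS; rewrite mulrDr mulr1 expr2; lra.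
Qed.

(** Here [L] is an upper bound for the binary logarithm of [n].  The last
hypothesis gives [2 k L <= p - 1] for [k = n %/ p], so that
[(p^k k!)^2 <= n^(2 k) <= 2 ^ (p - 1)]; this is what makes [A^2 S <= 1]. *)
Lemma not_POS_of_prime n p L :
    prime p -> (2 * p <= n)%N -> (n <= 2 ^ L)%N ->
    (2 * (n * L) <= p * p.-1)%N ->
  ~ POS_group [set: 'S_n]%G.
Proof.
move=> p_pr pn nL LP posS.
have p_gt0 := prime_gt0 p_pr; have p_gt1 := prime_gt1 p_pr.
have := POS_dvd p_pr _ posS; case/(_ _)/dvdnP => [|D HD]; first by lia.
have := @card_prime_rootsE _ p [set: 'I_n] n.+1 p_pr.
rewrite cardsT card_ord ltnSn => /(_ isT); rewrite sum_cycles_density //.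
have := divn_eq n p; have := ltn_pmod n p_gt0.
set k := (n %/ p)%N; set r := (n %% p)%N => rp nkr.
have k_gt1 : (1 < k)%N by rewrite /k leq_divRL.
case def_k: k (k_gt1) => [|[|k']] // _; rewrite big_ord_recr big_ord_recl /=.
pose A := (p ^ k * k`! * r`!)%N.
have A_gt0 : (0 < A)%N by rewrite !muln_gt0 expn_gt0 p_gt0 !fact_gt0.
rewrite -def_k.
have -> : cycles_density p k n = A%:R^-1.
  by rewrite /cycles_density ifT ?nkr ?leq_addr // addKn.
have -> : cycles_density p 0 n = n`!%:R^-1.
  by rewrite /cycles_density mul0n subn0 expn0 fact0 !mul1n.
set S : rat := \sum_(i < _) _ => cardE.
have nf0 : (0 : rat) < n`!%:R by rewrite ltr0n fact_gt0.
have S_gt0 : 0 < S.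
  rewrite /S big_ord_recl ltr_wpDr //.
    apply: sumr_ge0 => i _; rewrite /cycles_density; case: ifP => // _.
    by rewrite invr_ge0 ler0n.
  rewrite /cycles_density ifT; last by rewrite /bump /= mul1n; lia.
  by rewrite invr_gt0 ltr0n !muln_gt0 expn_gt0 p_gt0 !fact_gt0.
have cN : #|prime_roots p [set: 'I_n]|.-1%:R = n`!%:R * (A%:R^-1 + S) :> rat.
  have c_gt0 : (0 < #|prime_roots p [set: 'I_n]|)%N.
    by apply/card_gt0P; exists 1%g; rewrite inE perm_on1 expg1n eqxx.
  rewrite -subn1 natrB // cardE; field.
  by rewrite !pnatr_eq0 -!lt0n fact_gt0 A_gt0.
suff AS : A%:R ^+ 2 * S <= 1.
  have /eqP[] := unit_fraction_gap D S_gt0 AS A_gt0.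
  apply: (mulfI (lt0r_neq0 nf0)); rewrite mulr1 mulrCA -cN -natrM -HD //.
have S_le : S <= k%:R / (p * (p + r)`!)%:R.
  have -> : k%:R / (p * (p + r)`!)%:R
              = \sum_(i < k) (p * (p + r)`!)%:R^-1 :> rat.
    by rewrite sumr_const card_ord mulr_natl.
  rewrite def_k big_ord_recr /= -[S]addr0; apply: lerD; last first.
    by rewrite invr_ge0 ler0n.
  apply: ler_sum => i _; rewrite /cycles_density.
  have ik : ((p + r) <= n - (bump 0 i) * p)%N.
    by have := ltn_ord i; rewrite /bump /=; nia.
  rewrite ifT; last by lia.
  rewrite lef_pV2 ?posrE ?ltr0n ?muln_gt0 ?expn_gt0 ?p_gt0 ?fact_gt0 //.
  rewrite ler_nat leq_mul //; last by apply: leq_fact.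
  rewrite -[leqLHS]muln1 leq_mul ?fact_gt0 // /bump /= expnS.
  by rewrite leq_pmulr // expn_gt0 p_gt0.
have key : (A ^ 2 * k <= p * (p + r)`!)%N.
  have kpn : (k * p <= n)%N by rewrite nkr leq_addr.
  have kL : (L * k * 2 <= p.-1)%N.
    rewrite -(leq_pmul2l p_gt0); apply: leq_trans LP.
    by rewrite (_ : p * (L * k * 2) = 2 * (k * p * L))%N ?leq_mul //; lia.
  have L_gt0 : (0 < L)%N by case: (L) nL => //; lia.
  have kp : (k <= p)%N by nia.
  have pk : (p ^ k * k`! <= 2 ^ (L * k))%N.
    apply: (@leq_trans ((k * p) ^ k)%N).
      by rewrite mulnC expnMn leq_mul // leq_fact_exp.
    by rewrite expnM leq_exp2r ?(leq_trans kpn) // ltnW.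
  have pk2 : ((p ^ k * k`!) ^ 2 <= 2 ^ p.-1)%N.
    apply: (@leq_trans ((2 ^ (L * k)) ^ 2)%N); first by rewrite leq_exp2r.
    by rewrite -expnM leq_exp2l.
  rewrite /A expnMn mulnC leq_mul //.
  by apply: leq_trans (fact_add_lower rp); rewrite leq_mul.
apply: le_trans (_ : A%:R ^+ 2 * (k%:R / (p * (p + r)`!)%:R) <= 1).
  by rewrite ler_wpM2l // exprn_ge0 // ler0n.
rewrite mulrA ler_pdivrMr ?ltr0n ?muln_gt0 ?p_gt0 ?fact_gt0 // mul1r.
by rewrite -natrX -natrM ler_nat.
Qed.

End Gap.

(** * Existence of a suitable prime *)

(** By Legendre's formula the exponent of [p] in ['C(n, k)] is a sum over [i] of
[n %/ p^i - k %/ p^i - (n - k) %/ p^i].  Each term is at most [1], and it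
vanishes once [p^i > n], so at most [log_p n] terms contribute. *)
Lemma pfactor_bin_leq p n k : prime p -> 0 < n -> k <= n ->
  p ^ logn p 'C(n, k) <= n.
Proof.
move=> p_pr n_gt0 kn.
have p_gt1 := prime_gt1 p_pr; have p_gt0 := prime_gt0 p_pr.
have [t ptn npt] : exists2 t, p ^ t <= n & n < p ^ t.+1.
  by exists (trunc_log p n); rewrite ?trunc_logP ?trunc_log_ltn.
apply: (leq_trans _ ptn); rewrite leq_exp2l //.
have ext j : j <= n -> logn p j`! = \sum_(1 <= i < n.+1) j %/ p ^ i.
  move=> jn; rewrite logn_fact // (@big_cat_nat _ _ _ j.+1 1 n.+1) //=.
  rewrite [X in _ = _ + X]big1_seq ?addn0 // => i.
  rewrite mem_index_iota => /and3P[_ ji _].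
  by rewrite divn_small //; apply: leq_trans (ltn_expl i p_gt1); lia.
have E : logn p 'C(n, k)
      + (\sum_(1 <= i < n.+1) (k %/ p ^ i + (n - k) %/ p ^ i))
    = \sum_(1 <= i < n.+1) n %/ p ^ i.
  rewrite big_split /= -!ext ?leq_subr // -!lognM
          ?muln_gt0 ?fact_gt0 ?bin_gt0 //.
  by rewrite bin_fact.
have le_t : \sum_(1 <= i < n.+1) (p ^ i <= n) <= t.
  have tn : t <= n by rewrite (leq_trans (ltnW (ltn_expl t p_gt1)) ptn).
  rewrite (@big_cat_nat _ _ _ t.+1 1 n.+1) //= [X in _ + X]big1_seq.
    rewrite addn0 -[leqRHS]subn0 -subSS -[leqRHS]muln1 -sum_nat_const_nat.
    by apply: leq_sum => i _; exact: leq_b1.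
  move=> i; rewrite mem_index_iota => /and3P[_ ti _].
  by rewrite leqNgt (leq_trans npt) // leq_exp2l.
rewrite -(leq_add2r (\sum_(1 <= i < n.+1) (k %/ p ^ i + (n - k) %/ p ^ i))) E.
apply: leq_trans (leq_add le_t (leqnn _)); rewrite -big_split /=.
apply: leq_sum => i _.
have [pin|pin] := leqP (p ^ i) n; last by rewrite divn_small.
rewrite -{1}(subnKC kn) divnD ?expn_gt0 ?p_gt0 // addnC leq_add2r.
exact: leq_b1.
Qed.

(** ['C(n, k)] is a product of prime powers, each at most [n]; if all its prime
divisors were below [s] there would be at most [s] of them. *)
Lemma prime_of_bin n k s : 0 < n -> k <= n -> n ^ s < 'C(n, k) ->
  exists2 q, prime q & s <= q <= n.
Proof.
move=> n_gt0 kn Cs; have C_gt0 : 0 < 'C(n, k) by rewrite bin_gt0.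
have le_n q : q \in primes 'C(n, k) -> prime q /\ q <= n.
  move=> qC; have q_pr : prime q by move: qC; rewrite mem_primes => /andP[].
  split=> //.
  apply: leq_trans (pfactor_bin_leq q_pr n_gt0 kn).
  by rewrite -{1}(expn1 q) leq_pexp2l ?(prime_gt0 q_pr) // logn_gt0.
have [/hasP[q qC sq]|/hasPn small] := boolP (has (leq s) (primes 'C(n, k))).
  by have [q_pr qn] := le_n q qC; exists q => //; rewrite sq.
move: Cs; rewrite ltnNge => /negP[].
have sz : size (primes 'C(n, k)) <= s.
  rewrite -[leqRHS](size_iota 0).
  apply: uniq_leq_size (primes_uniq _) _ => q qC.
  by rewrite mem_iota /= add0n ltnNge; exact: small.
rewrite {1}(prod_prime_decomp C_gt0) prime_decompE big_map /=.
apply: (@leq_trans (n ^ size (primes 'C(n, k)))); last by rewrite leq_pexp2l.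
rewrite -[in leqRHS](card_ord (size _)) -prod_nat_const (big_nth 0) big_mkord.
apply: leq_prod => i _; have [q_pr _] := le_n _ (mem_nth 0 (ltn_ord i)).
exact: pfactor_bin_leq.
Qed.

Lemma central_bin_lower m : 2 ^ m <= 'C(m.*2, m).
Proof.
elim: m => // m IH; rewrite doubleS binS expnS mul2n -addnn.
have -> : 'C(m.*2.+1, m.+1) = 'C(m.*2.+1, m).
  by rewrite -bin_sub; [congr 'C(_, _) |]; lia.
have : 'C(m.*2, m) <= 'C(m.*2.+1, m).
  by case: (m) => // j; rewrite binS leq_addr.
lia.
Qed.

Lemma exp2_cubic L : 19 <= L -> 4 * L * (8 * L ^ 2 + 4) <= 2 ^ L.-1.
Proof.
suff step d : 4 * (19 + d) * (8 * (19 + d) ^ 2 + 4) <= 2 ^ (18 + d).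
  move=> L19; have := step (L - 19); rewrite subnKC //.
  by rewrite (_ : 18 + (L - 19) = L.-1) //; lia.
elim: d => [|d IH]; first by rewrite !addn0; lia.
have -> : 2 ^ (18 + d.+1) = 2 * 2 ^ (18 + d) by rewrite addnS expnS.
apply: (leq_trans _ (leq_mul (leqnn 2) IH)).
rewrite -!mulnn; nia.
Qed.

(** The prime comes from ['C(2 m, m)] with [m = n %/ 4], whose value, at least
[2 ^ m], forces a prime divisor at least [s = m %/ L].  As [s] has order
[n / (4 L)], the condition [2 n L <= s (s - 1)] says that [n] is at least
about [32 L^3], which holds from [L = 19] on. *)
Lemma prime_in_range n L : 19 <= L -> 2 ^ L.-1 <= n -> n < 2 ^ L ->
  exists p, [/\ prime p, 2 * p <= n & 2 * (n * L) <= p * p.-1].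
Proof.
move=> L19 nL Ln; have L_gt0 : 0 < L by lia.
have cub := leq_trans (exp2_cubic L19) nL.
pose m := n %/ 4; pose s := m %/ L.
have m_eq := divn_eq n 4; have m_lt := ltn_pmod n (isT : 0 < 4).
have s_eq := divn_eq m L; have s_lt := ltn_pmod m L_gt0.
rewrite -/m -/s in m_eq s_eq.
have n_lt : n < 4 * L * s.+1 by nia.
have s_big : 8 * L ^ 2 + 4 <= s.
  have : 4 * L * (8 * L ^ 2 + 4) < 4 * L * s.+1 by lia.
  by rewrite ltn_pmul2l ?ltnS //; lia.
have [||| q q_pr /andP[sq qm]] := @prime_of_bin m.*2 m s.
- by nia.
- by lia.
- apply: leq_trans (central_bin_lower m).
  apply: (@leq_ltn_trans ((2 ^ L.-1) ^ s)).
    by rewrite leq_exp2r; [have := expnS 2 L.-1; rewrite prednK //; lia | lia].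
  rewrite -expnM ltn_exp2l //; nia.
exists q; split=> //; first by lia.
apply: (@leq_trans (s * s.-1)); last by apply: leq_mul => //; lia.
have : 2 * (n * L) <= 8 * L ^ 2 * s.+1.
  rewrite (_ : 8 * L ^ 2 * s.+1 = 2 * (4 * L * s.+1 * L)); last by ring.
  by rewrite leq_mul2l leq_mul2r (ltnW n_lt) orbT.
move/leq_trans; apply.
have : (8 * L ^ 2) * s.+1 <= (s - 4) * s.+1 by rewrite leq_mul2r; lia.
nia.
Qed.

(** * Small degrees, by counting involutions *)

Fixpoint square_root_count (n : nat) : nat :=
  match n with
  | m.+1 =>
    match m with
    | l.+1 => square_root_count m + m * square_root_count l
    | 0 => 1
    end
  | 0 => 1
  end.

Lemma card_square_roots (T : finType) (A : {set T}) :
  #|prime_roots 2 A| = square_root_count #|A|.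
Proof.
have [n] := ubnP #|A|; elim: n => // n IH in A *; rewrite ltnS => An.
have [A1|A1] := leqP #|A| 1.
  have -> : prime_roots 2 A = [set 1%g].
    apply/setP => x; rewrite !inE; apply/andP/eqP => [[xA _]|->].
      exact: (perm_on_id xA A1).
    by rewrite perm_on1 expg1n.
  by rewrite cards1; case: #|A| A1 => [|[]].
have [a aA] : exists a, a \in A by apply/set0Pn; rewrite -card_gt0 ltnW.
have cAa : #|A| = #|A :\ a|.+1 by rewrite (cardsD1 a A) aA.
rewrite (card_prime_roots_rec (isT : prime 2) aA
           (M := square_root_count (#|A| - 2))).
  rewrite IH ?cAa /=; last by lia.
  by case: #|A :\ a| cAa A1 => [->|m _ _] //=; rewrite ffactn1 subSS subn1.
by move=> B _ cB; rewrite IH cB //; lia.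
Qed.

(** Runs through the degrees from [m] on in binary arithmetic, where [a], [b]
and [f] stand for [square_root_count m], [square_root_count m.+1] and [m`!].
The predecessor of [a] discards the identity. *)
Fixpoint square_root_count_check (fuel : nat) (m a b f : N) : bool :=
  if fuel is k.+1 then
    ~~ N.eqb (N.modulo f (N.pred a)) 0
      && square_root_count_check k (N.succ m) b (N.add b (N.mul (N.succ m) a))
           (N.mul f (N.succ m))
  else true.

Lemma square_root_count_checkP fuel m :
    square_root_count_check fuel (N.of_nat m) (N.of_nat (square_root_count m))
      (N.of_nat (square_root_count m.+1)) (N.of_nat m`!) ->
  forall n, m <= n < m + fuel -> ~~ ((square_root_count n).-1 %| n`!).
Proof.
elim: fuel m => [|k IH] m; first by move=> _ n; lia.
move=> /andP[Hm Hk] n /andP[mn nk].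
move: mn; rewrite leq_eqVlt => /predU1P[<-|mn]; last first.
  apply: (IH m.+1); last by lia.
  move: Hk; rewrite -!Nat2N.inj_succ -!Nat2N.inj_mul -Nat2N.inj_add.
  by rewrite factS mulnC.
apply: contra Hm => /dvdnP[q ->]; apply/N.eqb_eq.
by rewrite -Nat2N.inj_pred (Nat2N.inj_mul q) N.Div0.mod_mul.
Qed.

Lemma not_POS_small n : 4 <= n < 256 -> ~ POS_group [set: 'S_n]%G.
Proof.
move=> n_lt posS; have := POS_dvd (isT : prime 2) _ posS.
rewrite card_square_roots cardsT card_ord => two_n.
have chk : square_root_count_check 252 (N.of_nat 4)
    (N.of_nat (square_root_count 4)) (N.of_nat (square_root_count 5))
    (N.of_nat 4`!) by vm_compute.
by have /negP[] := square_root_count_checkP chk n_lt; apply: two_n; lia.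
Qed.

(** * Conclusion *)

Theorem theorem3p1 (n : nat) (hn : 4 <= n) : ~ POS_group [set: 'S_n]%G.
Proof.
have [n_lt|n_ge] := ltnP n 256; first by apply: not_POS_small; rewrite hn.
pose L := (trunc_log 2 n).+1.
have n_gt0 : 0 < n by lia.
have /andP[Ln nL] : 2 ^ L.-1 <= n < 2 ^ L by apply: trunc_log_bounds.
have [p [p_pr pn np]] :
    exists p, [/\ prime p, 2 * p <= n & 2 * (n * L) <= p * p.-1].
  have [L19|L19] := leqP 19 L; first exact: prime_in_range L19 Ln nL.
  have L9 : 9 <= L by rewrite -(@ltn_exp2l 2) //; apply: leq_ltn_trans n_ge nL.
  move: L Ln nL L9 L19 => {}L Ln nL L9 L19.
  (* One prime can serve all [n] whose logarithm lies in a range [lo .. hi]; the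
     two inequalities are those needed at the ends of that range. *)
  have pick p lo hi : prime p -> lo <= L <= hi -> 4 * p <= 2 ^ lo ->
     2 * (2 ^ hi * hi) <= p * p.-1 ->
     exists p, [/\ prime p, 2 * p <= n & 2 * (n * L) <= p * p.-1].
    move=> p_pr /andP[loL Lhi] plo phi; exists p; split=> //.
      have : 2 ^ lo.-1 <= n by apply: leq_trans Ln; rewrite leq_exp2l //; lia.
      have : 2 ^ lo <= 2 * 2 ^ lo.-1 by rewrite -expnS leq_exp2l; lia.
      lia.
    apply: leq_trans phi; rewrite leq_mul2l /= leq_mul //.
    by apply: leq_trans (ltnW nL) _; rewrite leq_exp2l.
  have [?|?] := leqP L 9; first by apply: (pick 127 9 9 isT); lia.
  have [?|?] := leqP L 11; first by apply: (pick 251 10 11 isT); lia.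
  have [?|?] := leqP L 13; first by apply: (pick 509 12 13 isT); lia.
  have [?|?] := leqP L 15; first by apply: (pick 1021 14 15 isT); lia.
  by apply: (pick 4093 16 18 isT); lia.
exact: not_POS_of_prime p_pr pn (ltnW nL) np.
Qed.
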